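(* For every spider $S_{n,q}$ with $n$ vertices and $q\ge 3$ legs, and every integer $k\ge 4$, we have $c_k(S_{n,q})=n-1$.
   Context: All graphs are finite and simple. A spider with $q\ge 3$ legs is a tree obtained from $q$ paths (the legs), each with at least one edge and of arbitrary lengths, by identifying one endpoint of each into a single vertex (the center). Let $G$ be a graph and $k\ge 2$ an integer. A multiset $\mathscr{P}$ of paths in $G$ is a $k$-rainbow separating path system ($k$-RSPS) if its elements can be colored with (at most) $k$ colors so that for every pair of distinct edges $e_1,e_2\in E(G)$ there exist paths $P_1,P_2\in\mathscr{P}$ of distinct colors such that $P_1$ contains $e_1$ but not $e_2$, and $P_2$ contains $e_2$ but not $e_1$. The $k$-rainbow separation number $c_k(G)$ is the smallest cardinality (with multiplicity) of a $k$-RSPS of $G$. *)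

(* Defs.v *)
From HB Require Import structures.
From mathcomp Require Import all_boot.

Set Implicit Arguments.
Unset Strict Implicit.
Unset Printing Implicit Defensive.

Record sgraph := SGraph {
  vertex :> finType;
  adj : rel vertex;
  adj_sym : symmetric adj;
  adj_irr : irreflexive adj
}.

Definition edges (G : sgraph) : {set {set G}} :=
  [set [set x; y] | x in G, y in G & adj x y].

Definition isomorphic (G H : sgraph) : Prop :=
  exists f : G -> H, bijective f /\ forall x y, adj (f x) (f y) = adj x y.

(* A path is given by one of its (at most two) traversals x0, x1, ..., xr,
   with r >= 0; only its edge set matters below. *)
Record gpath (G : sgraph) := GPath {
  path_start : G;
  path_tail : seq G;
  path_adj : path (@adj G) path_start path_tail;
  path_uniq : uniq (path_start :: path_tail)
}.

Definition path_edges (G : sgraph) (p : gpath G) : seq {set G} :=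
  pairmap (fun x y => [set x; y]) (path_start p) (path_tail p).

(* A multiset of m paths is a family of paths indexed by 'I_m, so that
   repeated copies of a path may receive different colors. *)
Definition rainbow_separating (G : sgraph) (k m : nat)
    (P : 'I_m -> gpath G) : Prop :=
  exists color : 'I_m -> 'I_k,
    forall e1 e2 : {set G}, e1 \in edges G -> e2 \in edges G -> e1 != e2 ->
    exists i j : 'I_m,
      [/\ color i != color j,
          e1 \in path_edges (P i), e2 \notin path_edges (P i),
          e2 \in path_edges (P j) & e1 \notin path_edges (P j)].

(* [is_rainbow_separation_number G k c] means c_k(G) = c. *)
Definition is_rainbow_separation_number (G : sgraph) (k c : nat) : Prop :=
  (exists P : 'I_c -> gpath G, rainbow_separating k P) /\
  (forall m (P : 'I_m -> gpath G), rainbow_separating k P -> c <= m).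

(* The spider whose leg i has l i edges: None is the center, and
   Some (i, j) is the vertex of leg i at distance j + 1 from the center. *)
Section Spider.
Variables (q : nat) (l : 'I_q -> nat).

Definition spider_vertex : finType := option {i : 'I_q & 'I_(l i)}.

Definition spider_next (u v : spider_vertex) : bool :=
  match u, v with
  | None, Some b => nat_of_ord (tagged b) == 0
  | Some a, Some b =>
      (tag a == tag b) && (nat_of_ord (tagged b) == (tagged a).+1)
  | _, None => false
  end.

Definition spider_adj : rel spider_vertex :=
  fun u v => spider_next u v || spider_next v u.

Lemma spider_adj_sym : symmetric spider_adj.
Proof. by move=> u v; rewrite /spider_adj orbC. Qed.

Lemma spider_adj_irr : irreflexive spider_adj.
Proof.
by case=> [a|] //; rewrite /spider_adj /= orbb eqxx /= -[X in X == _]addn0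
  -addn1 eqn_add2l.
Qed.

Definition spider : sgraph := SGraph spider_adj_sym spider_adj_irr.

End Spider.

Definition is_spider (q : nat) (G : sgraph) : Prop :=
  exists l : 'I_q -> nat, (forall i, 0 < l i) /\ isomorphic G (spider l).

(* Main.v *)
Require Import Defs.
From mathcomp Require Import all_boot.
From mathcomp Require Import zify.

Set Implicit Arguments.
Unset Strict Implicit.
Unset Printing Implicit Defensive.

(** Every edge of a spider joins a non-central vertex [a] to its neighbor
[par a] closer to the center, so the [n - 1] non-central vertices serve as
names for the edges. Edge [a] is central when [par a] is the center, and
otherwise [par a] also names the preceding edge of the leg.

Lower bound. The top of a path is the set of its edges whose predecessor it
does not contain, where central edges count as having no predecessor. A path
that contains a non-central edge but not its predecessor never leaves the part
of the leg beyond that edge, so its top is this single edge; any other path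
has only central edges in its top. Thus every top has at most two edges
([card_top]). If [a] is not central, separating it from its predecessor gives
a path with top exactly [a]. If [a] is central, either some path has top
exactly [a], or some path has top [a, c], and separating [a] from [c] gives
another path whose top contains [a]. If every path shares a weight of 2 among
the edges of its top, every edge receives at least 2, hence there are at least
as many paths as edges ([double_count], [spider_lower_bound]).

Upper bound. Let [prev_edge a] be the preceding edge of the leg or, for
central [a], the central edge of the cyclically preceding leg. For each edge
[a], the edges [b] with [b = a] or [prev_edge b = a] form a path of at most
three edges ([exists_prev_edge_path]). So edge [b] lies on exactly two of these
paths, those of [b] and [prev_edge b]. If [prev_edge e = f], separating [e]
and [f] requires the paths of [e] and [prev_edge f] to differ in color; if [e]
and [f] have the same [prev_edge], the paths of [e] and [f] must differ;
otherwise each of the two paths of [e] can be used with each of those of [f],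
and it suffices that the four do not all have the same color
([separated_by_prev_pairs]). A coloring with four colors that meets these
conditions comes from one of the cycle of legs ([cycle_coloring]), continued
with period three along each leg ([exists_spider_coloring]). *)

(** * Invariance under isomorphism *)

Lemma mem_edges (G : sgraph) (e : {set G}) :
  reflect (exists x y, adj x y /\ e = [set x; y]) (e \in edges G).
Proof.
apply: (iffP imset2P) => [[x y _]|[x [y [xy ->]]]].
  by rewrite inE => /andP[_ xy] ->; exists x, y.
by exists x y; rewrite ?inE ?xy.
Qed.

Section Transfer.
Variables (G H : sgraph) (f : G -> H).
Hypotheses (f_bij : bijective f) (fP : forall x y, adj (f x) (f y) = adj x y).

Lemma map_path_adj (p : gpath G) :
  path (@adj H) (f (path_start p)) (map f (path_tail p)).
Proof.
by rewrite path_map (eq_path (e' := @adj G)) ?path_adj // => x y; apply: fP.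
Qed.

Lemma map_path_uniq (p : gpath G) :
  uniq (f (path_start p) :: map f (path_tail p)).
Proof.
by rewrite -map_cons map_inj_uniq ?path_uniq //; apply: bij_inj.
Qed.

Definition map_gpath (p : gpath G) : gpath H :=
  GPath (map_path_adj p) (map_path_uniq p).

Lemma path_edges_map (p : gpath G) :
  path_edges (map_gpath p) = [seq f @: e | e : {set G} <- path_edges p].
Proof.
case: p => x s adj_s uniq_s; rewrite /path_edges /= {adj_s uniq_s}.
by elim: s x => //= y s IHs x; rewrite IHs imsetU1 imset_set1.
Qed.

Lemma edges_map (e : {set H}) :
  e \in edges H -> exists2 e', e' \in edges G & e = f @: e'.
Proof.
have [g fK gK] := f_bij.
case/mem_edges=> x [y [xy ->]]; exists [set g x; g y].
  by apply/mem_edges; exists (g x), (g y); rewrite -fP !gK.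
by rewrite imsetU1 imset_set1 !gK.
Qed.

Lemma rainbow_separating_map k m (P : 'I_m -> gpath G) :
  rainbow_separating k P -> rainbow_separating k (fun i => map_gpath (P i)).
Proof.
case=> color sepP; exists color => e1 e2.
case/edges_map=> d1 d1E -> /edges_map[d2 d2E ->] neq_d.
have [|i [j]] := sepP d1 d2 d1E d2E; first by apply: contraNneq neq_d => ->.
have inj := imset_inj (bij_inj f_bij).
by exists i, j; rewrite !path_edges_map !(mem_map inj).
Qed.

End Transfer.

Lemma isomorphic_sym (G H : sgraph) : isomorphic G H -> isomorphic H G.
Proof.
case=> f [[g fK gK] fP]; exists g; split; first by exists f.
by move=> x y; rewrite -fP !gK.
Qed.

Lemma is_rainbow_separation_number_iso (G H : sgraph) k c :
  isomorphic G H ->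
  is_rainbow_separation_number H k c -> is_rainbow_separation_number G k c.
Proof.
move=> isoGH [[P sepP] minH]; split.
  have [g [g_bij gP]] := isomorphic_sym isoGH.
  by eexists; apply: (rainbow_separating_map g_bij gP sepP).
move=> m Q sepQ; have [f [f_bij fP]] := isoGH.
exact: minH (rainbow_separating_map f_bij fP sepQ).
Qed.

(** * Two counting lemmas *)

(** A path meets a vertex in at most two edges. The right-hand side records
whether the start of the path is the vertex in question, in which case there is
only one such edge: the induction along the path needs this sharper bound. *)
Lemma count_incident_edges (G : sgraph) (v x : G) s :
  uniq (x :: s) ->
  count (fun e : {set G} => v \in e) (pairmap (fun y z => [set y; z]) x s)
    <= (v \in x :: s) + (v \in s).
Proof.
elim: s x => //= y s IHs x /andP[x_ys uniq_ys].
have := IHs y uniq_ys; move: x_ys uniq_ys => /=.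
rewrite !inE negb_or => /andP[/negPf xy /negPf xs] /andP[ys _].
have [->|vx] := eqVneq v x; first by rewrite xy xs /= => count_le; lia.
have [->|vy] := eqVneq v y; last by rewrite /= => count_le; lia.
by rewrite (negPf ys) /= => count_le; lia.
Qed.

(** Each index [p] gives every element of [T p] the weight [3 - #|T p|], that is
2 for a singleton and 1 for a pair, hence at most 2 in total. By the second
hypothesis every element receives at least 2. *)
Lemma double_count (A : finType) m (T : 'I_m -> {set A}) :
  (forall p, #|T p| <= 2) ->
  (forall a, exists p p', [/\ a \in T p, a \in T p' &
     p != p' \/ T p = [set a]]) ->
  #|A| <= m.
Proof.
move=> T_le2 T_cov.
pose w p a := (a \in T p) * (3 - #|T p|).
have w_path p : \sum_a w p a <= 2.
  rewrite -big_distrl /=.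
  have -> : \sum_a (a \in T p : nat) = #|T p|.
    by rewrite -sum1_card [RHS]big_mkcond; apply: eq_bigr => a _; case: ifP.
  by case: #|T p| (T_le2 p) => [|[|[|]]].
have w_ge1 p a : a \in T p -> 1 <= w p a.
  by rewrite /w => ->; have := T_le2 p; lia.
have w_elt a : 2 <= \sum_p w p a.
  have [p [p' [aTp aTp' [pp'|Tp]]]] := T_cov a.
    rewrite (bigD1 p) // (bigD1 p') /=; last by rewrite eq_sym.
    by have := w_ge1 _ _ aTp; have := w_ge1 _ _ aTp'; lia.
  by rewrite (bigD1 p) //= {1}/w Tp set11 cards1.
rewrite -(leq_pmul2r (isT : 0 < 2)) -sum_nat_const.
rewrite -[m in m * 2]card_ord -sum_nat_const.
apply: leq_trans (leq_sum _ _) _; first by move=> a _; apply: w_elt.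
by rewrite exchange_big; apply: leq_sum => p _; apply: w_path.
Qed.

(** * Vertices and edges of a spider *)

(** A path that never crosses the boundary of [D] lies on one side of it.
Inward crossings are excluded as well by symmetry of adjacency. *)
Lemma path_edges_cut (G : sgraph) (p : gpath G) (D : {set G}) :
  (forall x y, adj x y -> [set x; y] \in path_edges p -> x \in D -> y \in D) ->
  forall e1 e2 x y, e1 \in path_edges p -> e2 \in path_edges p ->
    x \in e1 -> y \in e2 -> x \in D -> y \in D.
Proof.
move=> closedD.
suff sameD e v : e \in path_edges p -> v \in e ->
    (v \in D) = (path_start p \in D).
  by move=> e1 e2 x y e1p e2p xe1 ye2; rewrite (sameD e1) // (sameD e2).
rewrite /path_edges in closedD *; move: closedD (path_adj p).
elim: (path_tail p) (path_start p) => //= y s IHs x closedD /andP[adj_xy adj_s].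
have xyD : (y \in D) = (x \in D).
  apply/idP/idP; last by apply: closedD; rewrite ?mem_head.
  by apply: closedD; rewrite 1?adj_sym // setUC mem_head.
have {}IHs : e \in pairmap (fun u w => [set u; w]) y s -> v \in e ->
    (v \in D) = (y \in D).
  by apply: IHs => // u w uw us; apply: closedD; rewrite // inE us orbT.
rewrite inE => /predU1P[->|es ve]; last by rewrite IHs.
by rewrite !inE => /pred2P[] ->.
Qed.

Section SpiderEdges.
Variables (q : nat) (l : 'I_q -> nat).
Notation S := (spider l).
Notation A := {i : 'I_q & 'I_(l i)}.
Implicit Types (a b c : A) (p : gpath S).

Definition depth a : nat := tagged a.

Lemma node_eq a b : tag a = tag b -> depth a = depth b -> a = b.
Proof.
by case: a b => i x [j y] /= eq_ij; case: j / eq_ij y => y /val_inj /= ->.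
Qed.

(** The neighbor of [a] towards the center, where [None] is the center; this is
both the other end of the edge named by [a] and, when it is [Some b], the name
[b] of the preceding edge. *)
Definition par a : option A :=
  if depth a is j.+1
  then omap (existT _ (tag a)) (insub j : option 'I_(l (tag a))) else None.

Variant par_spec a : option A -> nat -> Prop :=
  | ParCenter : par_spec a None 0
  | ParNode b of tag b = tag a : par_spec a (Some b) (depth b).+1.

Lemma parP a : par_spec a (par a) (depth a).
Proof.
rewrite /par; case def_d: (depth a) => [|j]; first exact: ParCenter.
have ltj : j < l (tag a).
  by rewrite (leq_trans _ (ltn_ord (tagged a))) // -/(depth a) def_d.
rewrite (insubT (fun x => x < l (tag a)) ltj) /=.
exact: (@ParNode a (existT _ (tag a) (Ordinal ltj))).
Qed.

Lemma par_depth a b : par a = Some b -> tag a = tag b /\ depth a = (depth b).+1.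
Proof. by case: parP => // c tc [<-]. Qed.

Lemma par_center a : par a = None -> depth a = 0.
Proof. by case: parP. Qed.

Lemma par_inj a b c : par a = Some c -> par b = Some c -> a = b.
Proof.
by move=> /par_depth[ta da] /par_depth[tb db]; apply: node_eq; congruence.
Qed.

Lemma spider_next_par (u v : S) :
  spider_next u v = if v is Some b then u == par b else false.
Proof.
case: v => [b|]; last by case: u.
rewrite /spider_next -/(depth b).
case: (parP b) => [|c tc]; case: u => [a|] //=; rewrite ?andbF //.
rewrite -/(depth a) eqSS -tc -[RHS]/(a == c).
by apply/andP/eqP => [[/eqP ta /eqP da]|-> //]; apply: node_eq.
Qed.

Definition edge_of a : {set S} := [set par a; Some a].

Lemma adj_par a : @adj S (par a) (Some a).
Proof. by rewrite /= /spider_adj spider_next_par eqxx. Qed.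

Lemma spider_adjP (u v : S) : adj u v ->
  exists a, (u = par a /\ v = Some a) \/ (u = Some a /\ v = par a).
Proof.
rewrite /= /spider_adj !spider_next_par => /orP[].
  by case: v => // a /eqP->; exists a; left.
by case: u => // a /eqP->; exists a; right.
Qed.

Lemma spider_edgesP (e : {set S}) :
  reflect (exists a, e = edge_of a) (e \in edges S).
Proof.
apply: (iffP (mem_edges e)) => [[x [y [xy ->]]]|[a ->]]; last first.
  by exists (par a), (Some a); split=> //; apply: adj_par.
by have [a [[-> ->]|[-> ->]]] := spider_adjP xy; exists a; rewrite // setUC.
Qed.

Lemma edge_of_inj : injective edge_of.
Proof.
move=> a b eq_ab.
have : (Some a : S) \in edge_of b by rewrite -eq_ab !inE eqxx orbT.
rewrite !inE => /pred2P[/esym/par_depth[_ dab]|[]//].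
have : (Some b : S) \in edge_of a by rewrite eq_ab !inE eqxx orbT.
rewrite !inE => /pred2P[/esym/par_depth[_ dba]|[]//].
by move: dab; rewrite dba => /eqP; rewrite -addn2 -[X in X == _]addn0 eqn_add2l.
Qed.

(** * The lower bound *)

Definition covers p a := edge_of a \in path_edges p.

(** For a path inside a leg this is the edge nearest the center, for the other
paths with an edge it consists of their central edges. *)
Definition top p : {set A} :=
  [set a | covers p a & if par a is Some b then ~~ covers p b else true].

(** The edge named by [c] is the only one that leaves the part of the leg at or
beyond [c], so a path that contains [a] but not [c] stays in that part. *)
Lemma covers_below_top p a b c : a \in top p -> par a = Some c ->
  covers p b -> tag b = tag a /\ depth a <= depth b.
Proof.
rewrite inE => /andP[pa]; case Da: (par a) => [c'|//] pc [eq_c].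
rewrite {}eq_c in Da pc => pb.
pose D : {set S} := [set v | if v is Some d then
  (tag d == tag a) && (depth a <= (depth d).+1) else false].
have [ta da] := par_depth Da.
have DP : (par b : S) \in D.
  apply: (@path_edges_cut S p D _ _ _ (Some a) (par b) pa pb);
    rewrite ?inE ?eqxx ?orbT ?leqnSn //.
  (* The edge crossing the boundary of [D] would be that of [c]. *)
  move=> x y /spider_adjP[d [[-> ->]|[-> ->]]] pd; last first.
    have : c != d by apply: contraNneq pc => ->; rewrite /covers /edge_of setUC.
    rewrite !inE => cd /andP[/eqP td dd]; case Dd: (par d) => [d'|].
      have [td' dd'] := par_depth Dd; rewrite -td' td eqxx /= -dd'.
      rewrite leqNgt; apply: contraNN cd => ltda; apply/eqP/node_eq.
        by rewrite -ta.
      lia.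
    have d0 := par_center Dd; case/eqP: cd.
    by apply: node_eq; [rewrite -ta | lia].
  rewrite !inE; case Dd: (par d) => [d'|//].
  by have [-> ->] := par_depth Dd => /andP[-> /leqW].
move: DP; rewrite inE; case Db: (par b) => [b'|//].
by have [<- <-] := par_depth Db => /andP[/eqP].
Qed.

Lemma top_noncentral p a c : a \in top p -> par a = Some c -> top p = [set a].
Proof.
move=> ap Da; apply/setP=> b; rewrite in_set1; apply/idP/eqP=> [bp|->//].
have pb : covers p b by move: bp; rewrite inE => /andP[].
have pa : covers p a by move: ap; rewrite inE => /andP[].
have [tba dab] := covers_below_top ap Da pb.
have [_ da] := par_depth Da.
case Db: (par b) => [d|]; last by have := par_center Db; lia.
have [_ dba] := covers_below_top bp Db pa.
by apply: node_eq => //; lia.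
Qed.

(** A non-central edge in the top is alone there; central edges all contain the
center, which a path meets in at most two edges. *)
Lemma card_top p : #|top p| <= 2.
Proof.
have [/existsP[a /andP[ap Da]]|] :=
    boolP [exists a, (a \in top p) && (par a != None)].
  case Ea: (par a) Da => [c|//] _.
  by rewrite (top_noncentral ap Ea) cards1.
rewrite negb_exists => /forallP centr.
pose C := [seq e : {set S} <- path_edges p | None \in e].
have sub : {subset [seq edge_of a | a <- enum (top p)] <= C}.
  move=> e /mapP[a]; rewrite mem_enum => ap ->; rewrite mem_filter.
  have := centr a; rewrite ap /= negbK => /eqP Da.
  by rewrite !inE Da eqxx; move: ap; rewrite inE => /andP[].
rewrite cardE -(size_map edge_of).
apply: leq_trans (uniq_leq_size _ sub) _.
  by rewrite (map_inj_uniq edge_of_inj) enum_uniq.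
rewrite size_filter; have := count_incident_edges (None : S) (path_uniq p).
by move/leq_trans->; rewrite //; do 2!case: (_ \in _).
Qed.

Lemma spider_lower_bound k m (P : 'I_m -> gpath S) :
  1 < #|{: A}| -> rainbow_separating k P -> #|{: A}| <= m.
Proof.
move=> A_gt1 [color sepP].
have {}sepP a b : a != b -> exists i, covers (P i) a && ~~ covers (P i) b.
  move=> ab; have [] := sepP (edge_of a) (edge_of b).
  - by apply/spider_edgesP; exists a.
  - by apply/spider_edgesP; exists b.
  - by rewrite (inj_eq edge_of_inj).
  by move=> i [_ [_ ai bi _ _]]; exists i; apply/andP.
apply: (double_count (T := top \o P)) => [i|a /=]; first exact: card_top.
case Da: (par a) => [c|].
  have [|i /andP[ia ic]] := sepP a c.
    by have [_] := par_depth Da; apply: contra_eq_neq => ->; lia.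
  have ap : a \in top (P i) by rewrite inE ia Da.
  by exists i, i; split=> //; right; apply: top_noncentral Da.
have topE i : (a \in top (P i)) = covers (P i) a by rewrite inE Da andbT.
(* From here on [a] is central. Separating it from any other edge [b] gives a
   path that covers [a]. *)
have /existsP[b ba] : [exists b, b != a].
  rewrite -negb_forall; apply: contraTN A_gt1 => /forallP allA.
  rewrite -leqNgt -(card1 a) subset_leq_card //.
  by apply/subsetP=> x _; apply: allA.
rewrite eq_sym in ba.
have [i /andP[ia _]] := sepP a b ba.
have [top1|] := eqVneq (top (P i)) [set a].
  by exists i, i; rewrite topE; split=> //; right.
rewrite eqEsubset andbC sub1set topE ia /= => /subsetPn[c ci].
rewrite inE eq_sym => ac; have [i' /andP[i'a i'c]] := sepP a c ac.
exists i, i'; rewrite !topE; split=> //; left.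
by apply: contraNneq i'c => <-; move: ci; rewrite inE => /andP[].
Qed.

End SpiderEdges.

(** * The coloring *)

(** Here [x] stands for a path that contains exactly the edges [e] with [e = x]
or [pr e = x], so the conclusion says that these paths, colored by [color],
separate [e] from [f]. The first two hypotheses treat the pairs of edges with a
common path, where the two separating paths are forced. Without common path,
separation fails only if the four paths have the same color, and then both
[e] and [f] have two paths of equal color; the third hypothesis allows this
for one edge only. *)
Lemma separated_by_prev_pairs (A C : eqType) (pr : A -> A)
    (color : A -> C) :
  (forall a, color (pr (pr a)) != color a) ->
  (forall a b, pr a = pr b -> a != b -> color a != color b) ->
  (forall a b, color a = color (pr a) -> color b = color (pr b) -> a = b) ->
  forall e f, e != f -> exists x y, [/\ color x != color y,
    (e == x) || (pr e == x), ~~ ((f == x) || (pr f == x)),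
    (f == y) || (pr f == y) & ~~ ((e == y) || (pr e == y))].
Proof.
move=> c_pr2 c_sibl c_mono.
have pr2 a : pr (pr a) != a by apply: contraNneq (c_pr2 a) => ->.
have pr1 a : pr a != a by apply: contraNneq (pr2 a) => E; rewrite !E.
have adjacent e : [/\ color e != color (pr (pr e)),
    ~~ ((pr e == e) || (pr (pr e) == e)) &
    ~~ ((e == pr (pr e)) || (pr e == pr (pr e)))].
  split; rewrite ?negb_or ?pr1 ?pr2 //; first by rewrite eq_sym c_pr2.
  by rewrite eq_sym pr2 eq_sym pr1.
move=> e f ef; have [<-|pe_f] := eqVneq (pr e) f.
  have [c1 n1 n2] := adjacent e.
  by exists e, (pr (pr e)); split; rewrite ?eqxx ?orbT.
have [<-|pf_e] := eqVneq (pr f) e.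
  have [c1 n1 n2] := adjacent f; rewrite eq_sym in c1.
  by exists (pr (pr f)), f; split; rewrite ?eqxx ?orbT.
have [Epp|pp] := eqVneq (pr e) (pr f).
  exists e, f; split; rewrite ?eqxx //; first exact: c_sibl.
    by rewrite eq_sym (negPf ef) (negPf pf_e).
  by rewrite (negPf ef) (negPf pe_f).
have pick_pair x y : (e == x) || (pr e == x) -> (f == y) || (pr f == y) ->
    color x != color y -> exists u v, [/\ color u != color v,
    (e == u) || (pr e == u), ~~ ((f == u) || (pr f == u)),
    (f == v) || (pr f == v) & ~~ ((e == v) || (pr e == v))].
  move=> ex fy cxy; exists x, y; split=> //; rewrite negb_or.
    case/pred2P: ex => <-; first by rewrite eq_sym ef.
    by rewrite eq_sym pe_f eq_sym.
  case/pred2P: fy => <-; first by rewrite ef.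
  by rewrite eq_sym pf_e.
have [c1|] := eqVneq (color e) (color f); last first.
  by apply: pick_pair; rewrite eqxx.
have [c2|] := eqVneq (color e) (color (pr f)); last first.
  by apply: pick_pair; rewrite eqxx ?orbT.
have [c3|] := eqVneq (color (pr e)) (color f); last first.
  by apply: pick_pair; rewrite eqxx ?orbT.
by case/eqP: ef; apply: c_mono; congruence.
Qed.

Lemma exists_fresh k (s : seq 'I_k) : size s < k -> exists x, x \notin s.
Proof.
move=> size_s; apply/existsP; rewrite -[X in is_true X]negbK negb_exists.
apply/negP => /forallP all_s; move: size_s.
rewrite ltnNge -{1}[k]card_ord cardT.
by rewrite uniq_leq_size ?enum_uniq // => x _; have:= all_s x; rewrite negbK.
Qed.

Lemma val_ord_pred q (i : 'I_q) :
  ord_pred i = (if i == 0 :> nat then q.-1 else i.-1) :> nat.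
Proof.
have lt_iq := ltn_ord i; rewrite /=; case: eqVneq => [->|i0].
  by rewrite modn_small //; lia.
have -> : (i + q).-1 = i.-1 + q by lia.
by rewrite modnDr modn_small //; lia.
Qed.

(** Color the cycle 0, 1, 2, 0, 1, 2 and so on, with color 3 on the last
[q %% 3] vertices. Vertices at distance two then differ, and two neighbors
share a color only if [q %% 3 = 2], for the final pair 3, 3. Insisting on
different colors for all neighbors would fail for [q = 5], where any two
vertices of the cycle are at distance at most two and five colors would be
needed. *)
Lemma cycle_coloring q k : 3 <= q -> 4 <= k -> exists b : 'I_q -> 'I_k,
  (forall i, b (ord_pred (ord_pred i)) != b i) /\
  (forall i j, b i = b (ord_pred i) -> b j = b (ord_pred j) -> i = j).
Proof.
move=> q_ge3 k_ge4; pose col t := if t < q - q %% 3 then t %% 3 else 3.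
have col_lt t : col t < k.
  by rewrite (leq_trans _ k_ge4) // /col; case: ifP => // _; lia.
exists (fun i : 'I_q => Ordinal (col_lt i)); split=> [i|i j].
  rewrite -val_eqE -[_ == _]/(col (ord_pred (ord_pred i)) == col i).
  have := ltn_ord i; rewrite !val_ord_pred /col.
  by do ![case: eqP | case: ifP]; lia.
move=> /(congr1 val) ci /(congr1 val) cj; apply: val_inj.
have {ci}: col i = col (ord_pred i) by [].
have {cj}: col j = col (ord_pred j) by [].
have := ltn_ord i; have := ltn_ord j; rewrite !val_ord_pred /col /=.
by do ![case: eqP | case: ifP]; lia.
Qed.

(** * The upper bound *)

Section SpiderPaths.
Variables (q : nat) (l : 'I_q -> nat).
Hypothesis l_gt0 : forall i, 0 < l i.
Notation S := (spider l).
Notation A := {i : 'I_q & 'I_(l i)}.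
Implicit Types (a b c : A).

(** The first vertex of leg [i], which names its central edge. *)
Definition leg_root i : A := existT _ i (Ordinal (l_gt0 i)).

(** The central edges are arranged in a cycle, so that they too have a
predecessor. *)
Definition prev_edge a : A :=
  if par a is Some b then b else leg_root (ord_pred (tag a)).

Lemma leg_rootP a : par a = None -> a = leg_root (tag a).
Proof. by move/par_center=> da; apply: node_eq. Qed.

(** For non-central [a] the path is [a] followed by the next edge of the leg, if
any. For central [a] it comes from the central edge [a'] of the cyclically next
leg, goes through the center, and continues in the same way. *)
Lemma exists_prev_edge_path a :
  2 <= q -> exists p : gpath S,
    forall b, covers p b = (b == a) || (prev_edge b == a).
Proof.
move=> q_ge2.
suff [L [x [s [path_s uniq_s edges_s memL]]]] : exists L : seq A, exists x s,
   [/\ path (@adj S) x s, uniq (x :: s),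
       pairmap (fun u v : S => [set u; v]) x s = map (@edge_of q l) L &
       forall b, (b \in L) = (b == a) || (prev_edge b == a)].
  exists (GPath path_s uniq_s) => b.
  by rewrite /covers /path_edges /= edges_s (mem_map (@edge_of_inj _ _)).
(* [tl] is the edge after [a] in its leg, or is empty if [a] is the last one. *)
pose tl : seq A :=
  if [pick b | par b == Some a] is Some c then [:: c] else [::].
have mem_tl b : (b \in tl) = (par b == Some a).
  rewrite /tl; case: pickP => [c /eqP Dc|-> //].
  by rewrite inE; apply/eqP/eqP => [->|/par_inj/(_ Dc)].
have tl_path : path (@adj S) (Some a) (map Some tl).
  rewrite /tl; case: pickP => //= c /eqP Dc.
  by rewrite andbT -Dc; apply: adj_par.
have tl_edges : pairmap (fun u v : S => [set u; v]) (Some a) (map Some tl) =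
    map (@edge_of q l) tl.
  by rewrite /tl; case: pickP => //= c /eqP Dc; rewrite /edge_of Dc.
have tl_uniq : uniq tl by rewrite /tl; case: pickP.
have Some_inj : injective (@Some A) by move=> ? ? [].
have a_tl : a \notin tl.
  by rewrite mem_tl; apply/eqP=> /par_depth[_]; lia.
case Da: (par a) => [d|].
  exists (a :: tl), (Some d), (Some a :: map Some tl); split.
  - by apply/andP; split=> //; rewrite -Da; apply: adj_par.
  - rewrite -!map_cons (map_inj_uniq Some_inj) /= a_tl tl_uniq !andbT inE.
    have [_ dd] := par_depth Da; rewrite negb_or; apply/andP; split.
      by apply: contra_eq_neq dd => ->; lia.
    by rewrite mem_tl; apply/eqP=> /par_depth[_]; lia.
  - by rewrite /= tl_edges /edge_of Da.
  move=> b; rewrite inE mem_tl /prev_edge; case Db: (par b) => [d'|] //.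
  congr (_ || _); apply/esym/eqP => Ea.
  by have [_] := par_depth Da; rewrite -Ea.
pose a' := leg_root (ordS (tag a)).
have Da' : par a' = None by [].
have aa' : a' != a.
  apply/eqP => /(congr1 (fun c => nat_of_ord (tag c))) /=.
  have := ltn_ord (tag a); case: (ltngtP (tag a).+1 q) => // [lt_q|eq_q] _.
    by rewrite modn_small //; lia.
  by rewrite eq_q modnn; lia.
exists (a' :: a :: tl), (Some a'), (None :: Some a :: map Some tl); split.
- by apply/and3P; split=> //; rewrite -Da; apply: adj_par.
- rewrite /= !inE /= (map_inj_uniq Some_inj) tl_uniq !(mem_map Some_inj).
  rewrite a_tl andbT; apply/andP; split.
    by rewrite negb_or aa' mem_tl Da'.
  by rewrite andbT; apply/mapP => -[].
- by rewrite /= tl_edges /edge_of Da Da' setUC.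
move=> b; rewrite !inE mem_tl /prev_edge orbCA; congr (_ || _).
case Db: (par b) => [d|].
  by have /negPf-> : b != a' by apply/eqP=> E; rewrite E Da' in Db.
rewrite orbF; apply/eqP/eqP => [->|]; first by rewrite /= ordSK -leg_rootP.
move=> Ea; rewrite /a' -Ea /= ord_predK; exact: leg_rootP.
Qed.

(** Along leg [i] the colors repeat with period three as [b0 i], [b1 i], [b2 i],
where [b0] is the coloring of the cycle. Three consecutive edges of a leg then
have different colors; the second one moreover avoids the colors of the two
neighboring central edges: that of [ord_pred i] is two steps before it, and
that of [ordS i] has the same predecessor. It thus avoids three colors in all,
which takes a fourth one. Only central edges can have the color of their
predecessor, so the last condition is inherited from the cycle. *)
Lemma exists_spider_coloring k : 3 <= q -> 4 <= k -> exists color : A -> 'I_k,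
  [/\ forall a, color (prev_edge (prev_edge a)) != color a,
      forall a b, prev_edge a = prev_edge b -> a != b -> color a != color b &
      forall a b, color a = color (prev_edge a) ->
        color b = color (prev_edge b) -> a = b].
Proof.
move=> q_ge3 k_ge4; have [b0 [b0_pr2 b0_mono]] := cycle_coloring q_ge3 k_ge4.
have fresh1 i : exists x, x \notin [:: b0 i; b0 (ord_pred i); b0 (ordS i)].
  exact: exists_fresh.
have [b1 b1P] := fin_all_exists fresh1.
have fresh2 i : exists x, x \notin [:: b0 i; b1 i].
  by apply: exists_fresh; rewrite (leq_trans _ k_ge4).
have [b2 b2P] := fin_all_exists fresh2.
have b10 i : b1 i != b0 i by have := b1P i; rewrite !inE !negb_or => /and3P[].
have b1p i : b1 i != b0 (ord_pred i).
  by have := b1P i; rewrite !inE !negb_or => /and3P[].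
have b1S i : b1 i != b0 (ordS i).
  by have := b1P i; rewrite !inE !negb_or => /and3P[].
have b20 i : b2 i != b0 i by have := b2P i; rewrite !inE negb_or => /andP[].
have b21 i : b2 i != b1 i by have := b2P i; rewrite !inE negb_or => /andP[].
pose col i d := nth (b0 i) [:: b0 i; b1 i; b2 i] (d %% 3).
have colS i d : col i d.+1 != col i d /\ col i d.+2 != col i d.
  have [E|[E|E]] : d %% 3 = 0 \/ d %% 3 = 1 \/ d %% 3 = 2 by lia.
  - have [E1 E2] : d.+1 %% 3 = 1 /\ d.+2 %% 3 = 2 by lia.
    by rewrite /col E E1 E2 /= b10 b20.
  - have [E1 E2] : d.+1 %% 3 = 2 /\ d.+2 %% 3 = 0 by lia.
    by rewrite /col E E1 E2 /= b21 eq_sym b10.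
  have [E1 E2] : d.+1 %% 3 = 0 /\ d.+2 %% 3 = 1 by lia.
  by rewrite /col E E1 E2 /= [b0 i == _]eq_sym [b1 i == _]eq_sym b21 b20.
pose color a := col (tag a) (depth a).
have color_root a : par a = None -> color a = b0 (tag a).
  by move/par_center; rewrite /color => ->.
have color_second a d : par a = Some d -> par d = None ->
    color a = b1 (tag d).
  by move=> /par_depth[ta da] /par_center d0; rewrite /color ta da d0.
have pr_root a : par a = None ->
    [/\ par (prev_edge a) = None, tag (prev_edge a) = ord_pred (tag a) &
        color (prev_edge a) = b0 (ord_pred (tag a))].
  by rewrite /prev_edge => ->.
have pr_node a d : par a = Some d -> prev_edge a = d.
  by rewrite /prev_edge => ->.
have mixed a b d : par a = Some d -> par b = None ->
    prev_edge a = prev_edge b ->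
    color a != color b.
  move=> Da Db; have [Dp tp _] := pr_root b Db; rewrite (pr_node a d Da) => E.
  rewrite -{}E in Dp tp; rewrite (color_second a d) // (color_root b) //.
  by rewrite -[tag b]ord_predK -tp b1S.
exists color; split=> [a|a b|a b].
- case Da: (par a) => [d|].
    rewrite (pr_node a d Da); have [ta da] := par_depth Da.
    case Dd: (par d) => [e|].
      rewrite (pr_node d e Dd); have [td dd] := par_depth Dd.
      by rewrite /color ta td da dd eq_sym; case: (colS (tag e) (depth e)).
    have [_ _ ->] := pr_root d Dd.
    by rewrite (color_second a d) // eq_sym.
  have [Dp tp _] := pr_root a Da; have [_ _ ->] := pr_root _ Dp.
  by rewrite tp color_root.
- case Da: (par a) => [d|]; case Db: (par b) => [e|] Epr.
  + rewrite (pr_node a d Da) (pr_node b e Db) in Epr.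
    by rewrite Epr in Da; rewrite (par_inj Da Db) eqxx.
  + by move=> _; apply: mixed Da Db Epr.
  + by move=> _; rewrite eq_sym; apply: mixed Db Da (esym Epr).
  have [[_ ta _] [_ tb _]] := (pr_root a Da, pr_root b Db).
  case/eqP; rewrite (leg_rootP Da) (leg_rootP Db); congr leg_root.
  by apply: ord_pred_inj; rewrite -ta -tb Epr.
have root_of_mono d : color d = color (prev_edge d) -> par d = None.
  case Dd: (par d) => [e|//]; rewrite (pr_node d e Dd) => /eqP.
  have [td dd] := par_depth Dd; rewrite /color td dd.
  by have [/negPf-> _] := colS (tag e) (depth e).
move=> ca cb; have [Da Db] := (root_of_mono a ca, root_of_mono b cb).
have [[_ _ ea] [_ _ eb]] := (pr_root a Da, pr_root b Db).
rewrite ea (color_root a) // in ca; rewrite eb (color_root b) // in cb.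
by rewrite (leg_rootP Da) (leg_rootP Db) (b0_mono _ _ ca cb).
Qed.

Lemma spider_upper_bound k : 3 <= q -> 4 <= k ->
  exists P : 'I_#|{: A}| -> gpath S, rainbow_separating k P.
Proof.
move=> q_ge3 k_ge4.
have exP a := exists_prev_edge_path a (ltnW q_ge3).
have [P coversP] := fin_all_exists exP.
have [color [c_pr2 c_sibl c_mono]] := exists_spider_coloring q_ge3 k_ge4.
exists (fun i => P (enum_val i)), (fun i => color (enum_val i)) => e1 e2.
move=> /spider_edgesP[e ->] /spider_edgesP[f ->].
rewrite (inj_eq (@edge_of_inj _ _)) => ef.
have [x [y sep]] := separated_by_prev_pairs c_pr2 c_sibl c_mono ef.
exists (enum_rank x), (enum_rank y); rewrite !enum_rankK.
by move: sep; rewrite -!coversP.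
Qed.

End SpiderPaths.

Theorem theorem3p6 (S : sgraph) (n q k : nat) (hq : 3 <= q)
    (hS : is_spider q S) (hn : #|S| = n) (hk : 4 <= k) :
  is_rainbow_separation_number S k (n - 1).
Proof.
have [l [l_gt0 iso_Sl]] := hS; have [f [f_bij _]] := iso_Sl.
have -> : n - 1 = #|{: {i : 'I_q & 'I_(l i)}}|.
  by rewrite -hn (bij_eq_card f_bij) card_option subn1.
apply: is_rainbow_separation_number_iso iso_Sl _; split.
  exact: spider_upper_bound.
move=> m P; apply: spider_lower_bound.
apply: leq_trans (ltnW hq) _; rewrite -[q in q <= _]card_ord.
by apply: (leq_card (leg_root l_gt0)) => i j /(congr1 tag).
Qed.
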